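(* Let $\mathcal{X}$ be a set containing at least two distinct elements, and consider the competitive scepticism game with parameter $\mathcal{X}$ defined in the context. Let $c\ge 0$ be a real number and let $F:[1,\infty)\to[0,\infty)$ be an increasing function. Then Rival Sceptic has a strategy ensuring $$\mathcal{K}'_n\ge c\,\mathcal{K}_n+F(\mathcal{K}^*_n)\quad\text{for all } n$$ if and only if $c$ and $F$ satisfy $$\int_1^{\infty}\frac{F(y)}{y^2}\,\mathrm{d}y\le 1-c.$$
   Context: ''Increasing'' and ''positive'' are understood in the wide (non-strict) sense. $\overline{\mathbb{R}}=[-\infty,\infty]$, with the conventions $\infty+(-\infty):=\infty$ and $0\cdot\infty:=0$; $\overline{\mathbb{R}}^{\mathcal{X}}$ is the set of all functions $f:\mathcal{X}\to\overline{\mathbb{R}}$, and $[0,\infty]^{\mathcal{X}}$ the set of all functions $\mathcal{X}\to[0,\infty]$. An outer probability content on $\mathcal{X}$ is a function $\mathcal{E}:\overline{\mathbb{R}}^{\mathcal{X}}\to\overline{\mathbb{R}}$ satisfying: (1) if $f,g\in\overline{\mathbb{R}}^{\mathcal{X}}$ and $f\le g$ pointwise, then $\mathcal{E}(f)\le\mathcal{E}(g)$; (2) if $f\in\overline{\mathbb{R}}^{\mathcal{X}}$ and $c\in(0,\infty)$, then $\mathcal{E}(cf)=c\,\mathcal{E}(f)$; (3) if $f,g\in\overline{\mathbb{R}}^{\mathcal{X}}$, then $\mathcal{E}(f+g)\le\mathcal{E}(f)+\mathcal{E}(g)$; (4) for each $c\in\mathbb{R}$, $\mathcal{E}$ of the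 constant function $c$ equals $c$. Let $\mathbf{E}$ be the set of all outer probability contents on $\mathcal{X}$. The competitive scepticism game (with parameter $\mathcal{X}$) is a perfect-information game between Forecaster, Sceptic, Rival Sceptic and Reality. Initially $\mathcal{K}_0:=1$ and $\mathcal{K}'_0:=1$. At each step $n=1,2,\ldots$ the following moves are made, in this order, each player seeing all previous moves: - Forecaster announces $\mathcal{E}_n\in\mathbf{E}$; - Sceptic announces $f_n\in[0,\infty]^{\mathcal{X}}$ such that $\mathcal{E}_n(f_n)\le\mathcal{K}_{n-1}$; - Rival Sceptic announces $f'_n\in[0,\infty]^{\mathcal{X}}$ such that $\mathcal{E}_n(f'_n)\le\mathcal{K}'_{n-1}$; - Reality announces $x_n\in\mathcal{X}$; - the capitals are updated: $\mathcal{K}_n:=f_n(x_n)$ and $\mathcal{K}'_n:=f'_n(x_n)$. A strategy for Rival Sceptic specifies, at each step $n$, his legal move $f'_n$ as a function of the moves made before it (in particular, of $\mathcal{E}_1,f_1,x_1,\ldots,\mathcal{E}_{n-1},f_{n-1},x_{n-1},\mathcal{E}_n,f_n$). It ensures a property if the property holds for all legal moves of the other players. Put $\mathcal{K}^*_n:=\max_{0\le i\le n}\mathcal{K}_i\in[1,\infty]$, and understand $F(\infty)$ as $\lim_{y\to\infty}F(y)$. *)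

(* Defs.v *)
From mathcomp Require Import all_boot all_order all_algebra.
From mathcomp Require Import all_classical all_reals all_analysis.

Set Implicit Arguments.
Unset Strict Implicit.
Unset Printing Implicit Defensive.

Import Order.TTheory GRing.Theory Num.Theory.
Import numFieldNormedType.Exports.

Local Open Scope classical_set_scope.
Local Open Scope ring_scope.

(* The sums are dual sums ([%dE]): the convention is oo + (-oo) = oo, whereas
   the standard [+%E] gives -oo. *)
Record outer_probability_content (R : realType) (X : Type) := {
  opc_fun :> (X -> \bar R) -> \bar R;
  opc_le : forall f g : X -> \bar R,
    (forall x, (f x <= g x)%E) -> (opc_fun f <= opc_fun g)%E;
  opc_scale : forall (f : X -> \bar R) (c : R),
    0 < c -> opc_fun (fun x => c%:E * f x)%E = (c%:E * opc_fun f)%E;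
  opc_add : forall f g : X -> \bar R,
    (opc_fun (fun x => f x + g x)%dE <= (opc_fun f + opc_fun g)%dE)%E;
  opc_cst : forall c : R, opc_fun (fun=> c%:E) = c%:E
}.

Record round (R : realType) (X : Type) := Round {
  forecaster_move : outer_probability_content R X;
  sceptic_move : X -> \bar R;
  rival_move : X -> \bar R;
  reality_move : X
}.

Section Game.
Context {R : realType} {X : Type}.

(* A history lists the completed rounds, oldest first; the capitals are those
   reached at its end. *)
Definition capital (h : seq (round R X)) : \bar R :=
  last 1%E [seq sceptic_move r (reality_move r) | r <- h].

Definition rival_capital (h : seq (round R X)) : \bar R :=
  last 1%E [seq rival_move r (reality_move r) | r <- h].

Definition max_capital (h : seq (round R X)) : \bar R :=
  \big[maxe/-oo%E]_(i < (size h).+1) capital (take i h).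

Definition legal_bet (E : outer_probability_content R X) (K : \bar R)
    (f : X -> \bar R) : Prop :=
  (forall x, (0 <= f x)%E) /\ (E f <= K)%E.

Inductive legal_history : seq (round R X) -> Prop :=
| legal_nil : legal_history [::]
| legal_rcons (h : seq (round R X)) (r : round R X) :
    legal_history h ->
    legal_bet (forecaster_move r) (capital h) (sceptic_move r) ->
    legal_bet (forecaster_move r) (rival_capital h) (rival_move r) ->
    legal_history (rcons h r).

(* Rival Sceptic moves knowing the completed rounds and the moves of Forecaster
   and Sceptic in the current round. *)
Definition rival_strategy : Type :=
  seq (round R X) -> outer_probability_content R X -> (X -> \bar R) ->
  (X -> \bar R).

Definition legal_strategy (S : rival_strategy) : Prop :=
  forall (h : seq (round R X)) (E : outer_probability_content R X)
    (f : X -> \bar R),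
  legal_history h -> legal_bet E (capital h) f ->
  legal_bet E (rival_capital h) (S h E f).

(* In a play [p], indexed from 0, [p n] is the (n+1)-st round and [mkseq p n]
   consists of the first n rounds. *)
Definition legal_play (p : nat -> round R X) : Prop :=
  forall n, legal_history (mkseq p n).

Definition follows (S : rival_strategy) (p : nat -> round R X) : Prop :=
  forall n,
  rival_move (p n) = S (mkseq p n) (forecaster_move (p n)) (sceptic_move (p n)).

Definition ensures (S : rival_strategy) (P : (nat -> round R X) -> Prop) :
    Prop :=
  forall p : nat -> round R X, legal_play p -> follows S p -> P p.

End Game.

Arguments rival_strategy : clear implicits.

(* [F] on [1, oo], with F(oo) the limit of F at infinity; the value at -oo is
   never used. *)
Definition extend_at_infty (R : realType) (F : R -> R) (k : \bar R) : \bar R :=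
  match k with
  | EFin y => (F y)%:E
  | +oo%E => lim ((F y)%:E @[y --> +oo%R])
  | -oo%E => 0%E
  end.

(* Main.v *)
(* Sufficiency: put G(y) = int_y^oo F(t)/t^2 dt - F(y)/y, which is nonnegative
   and satisfies z (G(y) - G(z)) >= F(z) - F(y) for 1 <= y <= z. When the maximum
   of Sceptic's capital so far is m, Rival Sceptic bets (c + G(m)) f + F(m),
   which preserves K' >= (c + G(m)) K + F(m): if K rises above m to z, the gain
   z (G(m) - G(z)) pays for the increase of F.

   Necessity: Reality chooses between two points x and y, of probabilities 1/q
   and 1 - 1/q for some q > 1, and Sceptic stakes everything on x. As long as x
   occurs, K runs through the powers of q; whenever y occurs at K = q^n, Rival
   Sceptic must be left with F(q^n). Hence c plus the lower Riemann sum of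
   F(t)/t^2 over the powers of q is at most 1, and q tends to 1. *)

Require Import Defs.
From mathcomp Require Import all_boot all_order all_algebra.
From mathcomp Require Import all_classical all_reals all_analysis.
From mathcomp Require Import measurable_realfun ring lra.

Import Order.TTheory GRing.Theory Num.Theory.
Import numFieldNormedType.Exports DualAddTheory.

Local Open Scope classical_set_scope.
Local Open Scope ring_scope.

(** * The integral of F(y) / y^2 *)

Lemma continuous_invr_sqr (R : realType) (a b : R) : 0 < a ->
  {within `[a, b], continuous (fun x : R => (x ^+ 2)^-1)}.
Proof.
move=> a0; apply: continuous_in_subspaceT => x.
rewrite inE/= in_itv/= => /andP[ax _]; apply: cvgV.
  by rewrite expf_neq0 // gt_eqF // (lt_le_trans a0).
exact: exprn_continuous.
Qed.

Lemma integral_invr_sqr (R : realType) (a b : R) : 0 < a -> a < b ->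
  (\int[lebesgue_measure]_(x in `[a, b]) ((x ^+ 2)^-1)%:E
    = (a^-1 - b^-1)%:E)%E.
Proof.
move=> a0 ab.
have gt0 x : a <= x -> 0 < x by exact: lt_le_trans.
have dV x : 0 < x -> derivable (GRing.inv : R -> R) x 1.
  by move=> x0; apply: derivableV; [rewrite gt_eqF | exact: derivable_id].
have cV x : 0 < x -> {for x, continuous (fun x : R => - x^-1)}.
  by move=> x0; apply: cvgN; apply: cvgV; [rewrite gt_eqF | exact: cvg_id].
rewrite (@continuous_FTC2 _ _ (fun x => - x^-1)) //.
- by rewrite -EFinB opprK addrC.
- exact: continuous_invr_sqr.
- split.
  + move=> x; rewrite in_itv/= => /andP[/ltW/gt0 x0 _].
    exact/derivableN/dV.
  + exact: cvg_at_right_filter (cV _ a0).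
  + exact: cvg_at_left_filter (cV _ (gt0 _ (ltW ab))).
- move=> x; rewrite in_itv/= => /andP[/ltW/gt0 x0 _].
  rewrite derive1E deriveN; last exact: dV.
  rewrite (@deriveV _ _ id) ?gt_eqF//.
  by rewrite derive_id scaleNr opprK /GRing.scale/= mulr1.
Qed.

Section IncreasingFunction.
Context {R : realType} (F : R -> R).
Hypothesis F_ge0 : forall y : R, 1 <= y -> 0 <= F y.
Hypothesis F_incr : forall y z : R, 1 <= y -> y <= z -> F y <= F z.

Let mu := @lebesgue_measure R.
Let phi (y : R) : \bar R := (F y / y ^+ 2)%:E.

(** [F] is controlled only on [1, oo[; truncating its argument at 1 makes it monotone on the whole
    line, as general results on monotone functions require. *)
Lemma max1_incr : {homo (fun y : R => F (Num.max 1 y)) : y z / y <= z}.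
Proof.
move=> y z yz; apply: F_incr; first by rewrite le_max lexx.
by rewrite ge_max !le_max lexx yz orbT.
Qed.

Lemma measurable_div_sqr (D : set R) : measurable D -> D `<=` `[1, +oo[ ->
  measurable_fun D phi.
Proof.
move=> mD D1; apply/measurable_EFinP.
apply: (@eq_measurable_fun _ _ _ _ D
  (fun y : R => F (Num.max 1 y) * (Num.max 1 y ^+ 2)^-1 : R)).
  by move=> y /set_mem/D1; rewrite /= in_itv/= andbT => /max_r ->.
have maxP x : 1 <= Num.max 1 x :> R by rewrite le_max lexx.
apply: measurable_funM; first exact: nondecreasing_measurable max1_incr.
apply: nonincreasing_measurable => // x y xy.
have gt0 z : 0 < Num.max 1 z :> R by exact: lt_le_trans (maxP z).
rewrite lef_pV2 ?posrE ?exprn_gt0// lerXn2r ?nnegrE ?(ltW (gt0 _))//.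
by rewrite ge_max !le_max lexx xy orbT.
Qed.

Lemma div_sqr_ge0 (y : R) : 1 <= y -> (0 <= phi y)%E.
Proof. by move=> y1; rewrite lee_fin divr_ge0 ?F_ge0 ?sqr_ge0. Qed.

(** Between [a] and [b] the function [F] stays between its end values, and 1/y^2 integrates to 1/a -
    1/b. The interval is half-open so that consecutive cells concatenate; it is closed in the proof,
    where the antiderivative applies. *)
Lemma integral_div_sqr_bounds (a b : R) : 1 <= a -> a < b ->
  ((F a * (a^-1 - b^-1))%:E <= \int[mu]_(y in `[a, b[) phi y
   <= (F b * (a^-1 - b^-1))%:E)%E.
Proof.
move=> a1 ab.
have a0 : 0 < a by exact: lt_le_trans a1.
have sub1 : [set` `[a, b]] `<=` [set` `[1, +oo[ : interval R].
  by move=> x /=; rewrite !in_itv/= andbT => /andP[/(le_trans a1)].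
rewrite integral_itv_bndo_bndc; last first.
  apply: measurable_div_sqr => // x xab; apply: sub1.
  exact: subset_itv_co_cc xab.
have mV : measurable_fun `[a, b]%classic (fun x : R => ((x ^+ 2)^-1)%:E).
  apply/measurable_EFinP.
  apply: subspace_continuous_measurable_fun (continuous_invr_sqr _ a b a0).
  exact: measurable_itv.
have V0 (x : R) : (0 <= ((x ^+ 2)^-1)%:E)%E by rewrite lee_fin invr_ge0 sqr_ge0.
have cst z : 1 <= z -> ((F z * (a^-1 - b^-1))%:E =
    \int[mu]_(y in `[a, b]) ((F z)%:E * ((y ^+ 2)^-1)%:E))%E.
  move=> z1; rewrite ge0_integralZl//; last by rewrite lee_fin F_ge0.
  by rewrite integral_invr_sqr.
have b1 : 1 <= b by rewrite (le_trans a1)// ltW.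
rewrite !cst//; apply/andP; split; apply: ge0_le_integral => //.
- by move=> x _; rewrite mule_ge0// lee_fin F_ge0.
- exact: measurable_funeM.
- exact: measurable_div_sqr.
- move=> x /=; rewrite in_itv/= => /andP[ax xb]; rewrite lee_fin.
  by rewrite ler_wpM2r ?invr_ge0 ?sqr_ge0// F_incr.
- by move=> x /sub1 /=; rewrite in_itv/= andbT => /div_sqr_ge0.
- exact: measurable_div_sqr.
- exact: measurable_funeM.
- move=> x /=; rewrite in_itv/= => /andP[ax xb]; rewrite lee_fin.
  by rewrite ler_wpM2r ?invr_ge0 ?sqr_ge0// F_incr// (le_trans a1).
Qed.

(** The right bound [e] is left general to serve both for tails up to infinity and for finite
    cells. *)
Lemma integral_div_sqr_split (a b : R) (e : itv_bound R) :
  1 <= a -> a <= b -> (BLeft b <= e)%O ->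
  (\int[mu]_(y in [set` Interval (BLeft a) e]) phi y =
   \int[mu]_(y in `[a, b[) phi y +
   \int[mu]_(y in [set` Interval (BLeft b) e]) phi y)%E.
Proof.
move=> a1 ab be.
have E : [set` Interval (BLeft a) e]
       = [set` `[a, b[] `|` [set` Interval (BLeft b) e].
  by rewrite -itv_bndbnd_setU// bnd_simp.
have sub1 : [set` Interval (BLeft a) e] `<=` [set` `[1, +oo[ : interval R].
  move=> x /=; rewrite itv_boundlr => /andP[+ _]; rewrite bnd_simp in_itv/= andbT.
  exact: le_trans.
rewrite {1}E ge0_integral_setU//.
- by rewrite -E; exact: measurable_div_sqr.
- by move=> x; rewrite -E => /sub1 /=; rewrite in_itv/= andbT => /div_sqr_ge0.
- apply/disj_set2P/seteqP; split=> // x [/=]; rewrite in_itv/= => /andP[_ xb].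
  by rewrite itv_boundlr bnd_simp => /andP[/(lt_le_trans xb)]; rewrite ltxx.
Qed.

(* [G y = int_y^oo F(t)/t^2 dt - F(y)/y] *)
Lemma exists_slope (c : R) :
  (\int[mu]_(y in `[1%R, +oo[) phi y <= (1 - c)%:E)%E ->
  exists G : R -> R,
    [/\ c + G 1 + F 1 <= 1,
        forall y, 1 <= y -> 0 <= G y &
        forall y z, 1 <= y -> y <= z -> F z - F y <= z * (G y - G z)].
Proof.
move=> intF.
pose I y := (\int[mu]_(t in `[y, +oo[) phi t)%E.
have I0 y : 1 <= y -> (0 <= I y)%E.
  move=> y1; apply: integral_ge0 => x /=; rewrite in_itv/= andbT => yx.
  by apply: div_sqr_ge0; exact: le_trans yx.
have Ifin y : 1 <= y -> I y \is a fin_num.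
  move=> y1; rewrite ge0_fin_numE ?I0//.
  have : (I 1%R < +oo)%E by rewrite (le_lt_trans intF)// ltry.
  apply: le_lt_trans; rewrite {2}/I (integral_div_sqr_split 1 y +oo%O)// leeDr//.
  apply: integral_ge0 => x /=; rewrite in_itv/= => /andP[x1 _].
  exact: div_sqr_ge0.
have step y z : 1 <= y -> y < z -> F y * (y^-1 - z^-1) <= fine (I y) - fine (I z).
  move=> y1 yz; rewrite -lee_fin EFinB !fineK ?Ifin// ?(le_trans y1 (ltW yz))//.
  rewrite leeBrDr ?Ifin// ?(le_trans y1 (ltW yz))//.
  rewrite /I (integral_div_sqr_split y z +oo%O)// ?(ltW yz)// leeD2r//.
  by have /andP[] := integral_div_sqr_bounds y z y1 yz.
exists (fun y => fine (I y) - F y / y); split.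
(* At y = 1 the subtracted term is F(1), so G(1) + F(1) is the whole integral. *)
- rewrite divr1; suff : fine (I 1) <= 1 - c by lra.
  by rewrite -lee_fin fineK ?Ifin.
(* This is [step] as z tends to infinity: F(y) (1/y - 1/z) <= I(y) for every z > y. *)
- move=> y y1; rewrite subr_ge0.
  have y0 : 0 < y by exact: lt_le_trans y1.
  apply/ler_addgt0Pr => e e0.
  (* take z with F y / z <= e *)
  pose z := y + 1 + F y / e.
  have Fe : 0 <= F y / e by rewrite divr_ge0 ?F_ge0// ltW.
  have yz : y < z by rewrite /z -addrA ltrDl ltr_wpDr.
  have z0 : 0 < z by rewrite (lt_trans y0).
  have := step y z y1 yz; have : 0 <= fine (I z).
    by apply/fine_ge0/I0; rewrite (le_trans y1)// ltW.
  have : F y / z <= e.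
    rewrite ler_pdivrMr// /z mulrDr [e * (F y / e)]mulrCA divff ?gt_eqF// mulr1.
    by rewrite lerDr mulr_ge0 ?ltW// addr_gt0.
  by rewrite mulrBr; lra.
(* For y < z, multiply [step] by z: the term z F(y)/y cancels on both sides, leaving F(z) - F(y). *)
- move=> y z y1; rewrite le_eqVlt => /predU1P[<-|yz].
    by rewrite !subrr mulr0.
  have y0 : 0 < y by exact: lt_le_trans y1.
  have z0 : 0 < z by rewrite (lt_trans y0).
  have := step y z y1 yz.
  rewrite -(ler_pM2l z0); move: (fine (I y)) (fine (I z)) => p q.
  have -> : z * (F y * (y^-1 - z^-1)) = z * F y / y - F y by field; rewrite !gt_eqF.
  have -> : z * (p - F y / y - (q - F z / z)) = z * (p - q) - z * F y / y + F z.
    by field; rewrite !gt_eqF.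
  lra.
Qed.

End IncreasingFunction.

(** * Sums over the powers of q *)

Lemma expr_gt1_unbounded (R : archiRealFieldType) (q x : R) :
  1 < q -> exists n, x < q ^+ n.
Proof.
move=> q1; have d0 : 0 < q - 1 by rewrite subr_gt0.
have bernoulli n : n%:R * (q - 1) <= q ^+ n.
  elim: n => [|n IH]; first by rewrite mul0r.
  have -> : q ^+ n.+1 = q ^+ n + q ^+ n * (q - 1) by rewrite exprSr; ring.
  by rewrite -natr1 mulrDl mul1r lerD// ler_peMl ?exprn_ege1 ?ltW.
exists (Num.bound `|x / (q - 1)|); apply: lt_le_trans (bernoulli _).
rewrite -ltr_pdivrMr//.
exact: le_lt_trans (ler_norm _) (archi_boundP (normr_ge0 _)).
Qed.

Section GeometricSums.
Context {R : realType} (F : R -> R) (c : R).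
Hypothesis F_ge0 : forall y : R, 1 <= y -> 0 <= F y.
Hypothesis F_incr : forall y z : R, 1 <= y -> y <= z -> F y <= F z.

Let mu := @lebesgue_measure R.

(** On the cell from q^n to q^(n+1) the integral is at most F(q^(n+1)) (q^-n - q^-(n+1)), which is q
    times the summand of index n+1. Comparing the upper sum with the shifted lower sum thus costs
    only the factor q. *)
Lemma integral_geometric_le (q : R) : 1 < q ->
  (forall n, \sum_(i < n) (1 - q^-1) * (F (q ^+ i) / q ^+ i) <= 1 - c) ->
  (\int[mu]_(y in `[1%R, +oo[) (F y / y ^+ 2)%:E <= (q * (1 - c))%:E)%E.
Proof.
move=> q1 sumF.
have q0 : 0 < q by rewrite (lt_trans _ q1).
have qn0 n : 0 < q ^+ n by rewrite exprn_gt0.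
have qn1 n : 1 <= q ^+ n by rewrite exprn_ege1// ltW.
have qSn n : q ^+ n < q ^+ n.+1 by rewrite exprSr ltr_pMr.
have qV : 0 <= 1 - q^-1 by rewrite subr_ge0 invf_le1// ltW.
pose D n := [set` `[1, (q ^+ n)[ : interval R].
have D1 n : D n `<=` [set` `[1, +oo[ : interval R].
  by move=> x /=; rewrite !in_itv/= andbT => /andP[].
(* The [n] cells of [D n] use the indices 1 to n; the summand of index 0 is a nonnegative
   surplus. *)
have step n : (\int[mu]_(y in D n) (F y / y ^+ 2)%:E <=
    (q * (\sum_(i < n.+1) (1 - q^-1) * (F (q ^+ i) / q ^+ i)))%:E)%E.
  elim: n => [|n IH].
    rewrite /D expr0 set_itv_ge ?integral_set0 ?bnd_simp ?ltxx// lee_fin.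
    rewrite big_ord1 expr0 divr1 !mulr_ge0 ?F_ge0// ltW//.
  rewrite /D (integral_div_sqr_split F F_ge0 F_incr 1 (q ^+ n)) ?bnd_simp ?(ltW (qSn n))//.
  rewrite big_ord_recr/= mulrDr EFinD leeD//.
  have /andP[_ h] := integral_div_sqr_bounds F F_ge0 F_incr _ _ (qn1 n) (qSn n).
  apply: le_trans h _; rewrite lee_fin le_eqVlt; apply/orP; left; apply/eqP.
  by rewrite exprSr; field; rewrite !gt_eqF.
have -> : [set` `[1, +oo[ : interval R] = \bigcup_n D n.
  apply/seteqP; split=> [x|x [n _]]; last exact: D1.
  rewrite /= in_itv/= andbT => x1; have [n xn] := expr_gt1_unbounded _ q x q1.
  by exists n => //; rewrite /D/= in_itv/= x1.
have /cvg_lim <- // : (\int[mu]_(x in D i) (F x / x ^+ 2)%:E)%E @[i --> \oo]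
    --> (\int[mu]_(x in \bigcup_i D i) (F x / x ^+ 2)%:E)%E.
  apply: ge0_nondecreasing_set_cvg_integral.
  - move=> n m nm; apply/subsetPset => x; rewrite /D/= !in_itv/=.
    move=> /andP[-> xn]/=; apply: lt_le_trans xn _.
    by rewrite ler_weXn2l// ltW.
  - by move=> n; exact: measurable_itv.
  - by move=> n; apply: measurable_div_sqr => //; exact: measurable_itv.
  - by move=> n x /D1/=; rewrite in_itv/= andbT => x1; exact: div_sqr_ge0.
apply: lime_le.
  apply: ereal_nondecreasing_is_cvgn => n m nm; apply: ge0_subset_integral.
  - exact: measurable_itv.
  - exact: measurable_itv.
  - by apply: measurable_div_sqr => //; exact: measurable_itv.
  - by move=> x /D1/=; rewrite in_itv/= andbT => x1; exact: div_sqr_ge0.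
  - move=> x; rewrite /D/= !in_itv/= => /andP[-> xn]/=; apply: lt_le_trans xn _.
    by rewrite ler_weXn2l// ltW.
apply: nearW => n; apply: le_trans (step n) _.
by rewrite lee_fin ler_pM2l.
Qed.

End GeometricSums.

(** * The insuring strategy *)

Section OuterContent.
Context {R : realType} {X : Type} (E : outer_probability_content R X).

Lemma opc_ge0 (f : X -> \bar R) : (forall x, 0 <= f x)%E -> (0 <= E f)%E.
Proof. by move=> f0; have := opc_le E (f := fun=> 0%:E) f0; rewrite opc_cst. Qed.

(** This prices the intended bet. The constant [b] may be infinite, since F(oo) may be. *)
Lemma opc_affine (a : R) (b : \bar R) (f : X -> \bar R) :
  0 <= a -> (0 <= b)%E -> (forall x, 0 <= f x)%E ->
  (E (fun x => a%:E * f x + b) <= a%:E * E f + b)%E.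
Proof.
move=> a0 b0 f0.
have Ef0 : (0 <= a%:E * E f)%E by rewrite mule_ge0 ?opc_ge0.
case: b b0 => [b|_|]; rewrite ?leeNy_eq// ?lee_fin; last first.
  by rewrite addey ?leey// -ltNye (lt_le_trans _ Ef0) ?ltNyr.
move=> b0.
(* The two additions differ only on opposite infinities, excluded here by nonnegativity. *)
have -> : (fun x => a%:E * f x + b%:E)%E
        = (fun x => a%:E * f x + b%:E)%dE.
  apply/funext => x; have : (0 <= a%:E * f x)%E by rewrite mule_ge0.
  by case: (a%:E * f x)%E.
apply: le_trans (opc_add E _ _) _; rewrite opc_cst.
have -> : E (fun x => a%:E * f x)%E = (a%:E * E f)%E.
  (* The scaling axiom covers only positive factors; for a = 0 the function is the constant 0, even
     where [f] is infinite. *)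
  move: a0; rewrite le_eqVlt => /predU1P[<-|]; last exact: opc_scale.
  rewrite [RHS]mul0e -[RHS](opc_cst E 0); congr (opc_fun E _).
  by apply/funext => x; exact: mul0e.
by case: (a%:E * E f)%E Ef0.
Qed.

End OuterContent.

Section Capitals.
Context {R : realType} {X : Type}.
Implicit Types (h : seq (round R X)) (r : round R X).

Lemma capital_rcons h r : capital (rcons h r) = sceptic_move r (reality_move r).
Proof. by rewrite /capital map_rcons last_rcons. Qed.

Lemma rival_capital_rcons h r :
  rival_capital (rcons h r) = rival_move r (reality_move r).
Proof. by rewrite /rival_capital map_rcons last_rcons. Qed.

Lemma max_capital_nil : max_capital ([::] : seq (round R X)) = 1%E.
Proof. by rewrite /max_capital big_ord1 take0. Qed.

Lemma max_capital_rcons h r :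
  max_capital (rcons h r) = maxe (max_capital h) (capital (rcons h r)).
Proof.
rewrite /max_capital big_ord_recr/= take_size; congr maxe.
rewrite size_rcons; apply: eq_bigr => i _ /=.
rewrite -cats1 take_cat; have := ltn_ord i.
by rewrite ltnS leq_eqVlt => /predU1P[->|->//]; rewrite ltnn subnn cats0 take_size.
Qed.

Lemma max_capital_ge1 h : (1 <= max_capital h)%E.
Proof.
elim/last_ind: h => [|h r IH]; first by rewrite max_capital_nil.
by rewrite max_capital_rcons le_max IH.
Qed.

Lemma legal_rcons_bet h r : legal_history (rcons h r) ->
  legal_bet (forecaster_move r) (capital h) (sceptic_move r).
Proof.
move e : (rcons h r) => g hg; case: hg e => [/(congr1 size)|].
  by rewrite size_rcons.
by move=> {}g s _ bet _ /rcons_inj[-> ->].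
Qed.

Lemma legal_capital_ge0 h :
  legal_history h -> (0 <= capital h)%E /\ (0 <= rival_capital h)%E.
Proof.
case=> [|{}h r _ [f0 _] [g0 _]]; first by rewrite lee_fin.
by rewrite capital_rcons rival_capital_rcons.
Qed.

End Capitals.

Section ExtendedGrowth.
Context {R : realType} (c : R) (F G : R -> R).
Hypothesis c_ge0 : 0 <= c.
Hypothesis F_ge0 : forall y : R, 1 <= y -> 0 <= F y.
Hypothesis F_incr : forall y z : R, 1 <= y -> y <= z -> F y <= F z.
Hypothesis G_ge0 : forall y : R, 1 <= y -> 0 <= G y.
Hypothesis FG : forall y z : R, 1 <= y -> y <= z -> F z - F y <= z * (G y - G z).

(* The value 0 at [+oo] is the limit of [G]. *)
Definition slope_at_infty0 (k : \bar R) : R := if k is EFin y then G y else 0.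

Lemma is_cvg_incr_pinfty : cvg ((F y)%:E @[y --> +oo%R]).
Proof.
have /cvg_ex[l Fl] : cvg ((F (Num.max 1 y))%:E @[y --> +oo%R]).
  by apply: nondecreasing_is_cvge => y z yz; rewrite lee_fin max1_incr.
apply/cvg_ex; exists l; apply: cvg_trans Fl; apply: near_eq_cvg.
by near=> y; rewrite max_r//; near: y; exact: nbhs_pinfty_ge.
Unshelve. all: by end_near. Qed.

Lemma extend_at_infty_ge0 (k : \bar R) : (1 <= k)%E -> (0 <= extend_at_infty F k)%E.
Proof.
case: k => [y| |]//=; first by rewrite !lee_fin => /F_ge0.
move=> _; apply: lime_ge; first exact: is_cvg_incr_pinfty.
by near=> y; rewrite lee_fin F_ge0//; near: y; exact: nbhs_pinfty_ge.
Unshelve. all: by end_near. Qed.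

Lemma slope_at_infty0_ge0 (k : \bar R) : (1 <= k)%E -> 0 <= slope_at_infty0 k.
Proof. by case: k => [y| |]//=; rewrite lee_fin => /G_ge0. Qed.

(** With [m] the old maximum and [v] the new capital, the right side is what the intended bet yields
    and the left side what must be held afterwards. For finite v > m this is [FG]. For infinite [v]
    the right side is infinite unless the slope c + G(m) vanishes. *)
Lemma extended_growth (m v : \bar R) : (1 <= m)%E -> (0 <= v)%E ->
  ((c + slope_at_infty0 (maxe m v))%:E * v + extend_at_infty F (maxe m v)
    <= (c + slope_at_infty0 m)%:E * v + extend_at_infty F m)%E.
Proof.
move=> m1 v0; case: (leP v m) => // mv.
case: m m1 mv => [m| |//]; rewrite ?lee_fin; last by move=> _; rewrite ltNge leey.
move=> m1; case: v v0 => [v| |]//=; rewrite ?lee_fin ?lte_fin.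
  move=> v0 mv.
  change (((c + G v) * v + F v)%:E <= ((c + G m) * v + F m)%:E)%E.
  rewrite lee_fin; have := FG m v m1 (ltW mv); rewrite mulrBr !mulrDl ![v * _]mulrC. lra.
move=> _ _; have : 0 <= c + G m by rewrite addr_ge0 ?G_ge0.
rewrite le_eqVlt => /predU1P[cG0|cG0]; last first.
  by rewrite [leRHS](_ : _ = +oo%E) ?leey//= gt0_muley ?lte_fin.
have [c0 G0] : c = 0 /\ G m = 0.
  by move/esym/eqP: cG0; rewrite paddr_eq0 ?G_ge0// => /andP[/eqP-> /eqP->].
(* When G(m) = 0, [FG] gives F(y) - F(m) <= - y G(y) <= 0 for all y >= m, so the limit of [F] is at
   most F(m). *)
rewrite c0 G0 addr0 mul0e !add0e.
apply: lime_le; first exact: is_cvg_incr_pinfty.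
near=> y; have my : m <= y by near: y; exact/nbhs_pinfty_ge/num_real.
have y1 := le_trans m1 my.
rewrite lee_fin -subr_le0 (le_trans (FG m y m1 my))// G0 sub0r mulrN oppr_le0.
by rewrite mulr_ge0 ?G_ge0// (le_trans _ y1).
Unshelve. all: by end_near. Qed.

Context {X : Type}.
Implicit Types (h : seq (round R X)) (r : round R X).

Let intended_bet h (f : X -> \bar R) : X -> \bar R := fun x =>
  ((c + slope_at_infty0 (max_capital h))%:E * f x
   + extend_at_infty F (max_capital h))%E.

(* The bet 0 serves only on histories that this strategy cannot reach, where
   the intended bet may be too expensive. *)
Definition slope_strategy : rival_strategy R X := fun h E f =>
  if `[< legal_bet E (rival_capital h) (intended_bet h f) >]
  then intended_bet h f else cst 0%E.

Lemma slope_strategy_legal : legal_strategy slope_strategy.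
Proof.
move=> h E f hh _; rewrite /slope_strategy; case: asboolP => // _.
split=> //; rewrite /cst (opc_cst E 0).
by have [_] := legal_capital_ge0 h hh.
Qed.

(** This invariant is stronger than the property to be ensured, because G >= 0; the slack G(m) K
    finances later rises of the maximum. *)
Let affordable h := ((c + slope_at_infty0 (max_capital h))%:E * capital h
  + extend_at_infty F (max_capital h) <= rival_capital h)%E.

(** By [opc_affine] the intended bet costs at most (c + G(m)) E(f) + F(m), and E(f) <= K, so the
    invariant pays for it and the fallback is not taken. *)
Lemma slope_strategyE h (E : outer_probability_content R X) f :
  affordable h -> legal_bet E (capital h) f ->
  slope_strategy h E f = intended_bet h f.
Proof.
move=> hK [f0 fK]; rewrite /slope_strategy asboolT//.
have s0 : 0 <= c + slope_at_infty0 (max_capital h).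
  by rewrite addr_ge0 ?slope_at_infty0_ge0 ?max_capital_ge1.
have F0 := extend_at_infty_ge0 _ (max_capital_ge1 h).
split=> [x|]; first by rewrite adde_ge0 ?mule_ge0.
apply: le_trans (opc_affine E _ _ f s0 F0 f0) _; apply: le_trans hK.
by rewrite leeD2r// lee_wpmul2l.
Qed.

Lemma slope_strategy_ensures : c + G 1 + F 1 <= 1 ->
  ensures slope_strategy (fun p => forall n : nat,
    (c%:E * capital (mkseq p n) + extend_at_infty F (max_capital (mkseq p n))
       <= rival_capital (mkseq p n))%E).
Proof.
move=> init p legal_p Sp n.
suff hK : affordable (mkseq p n).
  apply: le_trans hK; rewrite leeD2r// lee_wpmul2r//.
    by have [] := legal_capital_ge0 _ (legal_p n).
  by rewrite lee_fin lerDl slope_at_infty0_ge0 ?max_capital_ge1.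
elim: n => [|n IH].
  by rewrite /affordable max_capital_nil /= mule1 lee_fin.
have bet : legal_bet (forecaster_move (p n)) (capital (mkseq p n))
    (sceptic_move (p n)).
  by apply: legal_rcons_bet; rewrite -mkseqS.
rewrite /affordable mkseqS max_capital_rcons capital_rcons rival_capital_rcons.
rewrite Sp slope_strategyE//; apply: extended_growth; first exact: max_capital_ge1.
by case: bet.
Qed.

End ExtendedGrowth.

(** * Staking everything on one point *)

Section TwoPointContent.
Context {R : realType} {X : Type} (x y : X) (p : R).
Hypothesis p01 : 0 < p < 1.

(** This is the expectation under the law giving weight [p] to [x] and 1 - p to [y]. With the dual
    sum it is additive, infinite values included. *)
Definition two_point_fun (f : X -> \bar R) : \bar R :=
  (p%:E * f x + (1 - p)%:E * f y)%dE.

Let p0 : 0 < p. Proof. by case/andP: p01. Qed.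
Let p1 : 0 < 1 - p. Proof. by case/andP: p01; rewrite subr_gt0. Qed.

Let daddeMr (a : R) (u v : \bar R) : 0 < a ->
  (a%:E * (u + v)%dE)%E = (a%:E * u + a%:E * v)%dE.
Proof.
move=> a0; case: u => [u| |]; case: v => [v| |];
  rewrite ?gt0_muley ?gt0_muleNy ?lte_fin//=.
by congr EFin; exact: mulrDr.
Qed.

Lemma two_point_le (f g : X -> \bar R) : (forall z, f z <= g z)%E ->
  (two_point_fun f <= two_point_fun g)%E.
Proof.
by move=> fg; rewrite /two_point_fun lee_dD// lee_wpmul2l// lee_fin ltW.
Qed.

Lemma two_point_scale (f : X -> \bar R) (a : R) : 0 < a ->
  two_point_fun (fun z => a%:E * f z)%E = (a%:E * two_point_fun f)%E.
Proof.
by move=> a0; rewrite /two_point_fun daddeMr// muleCA [in LHS](muleCA (1 - p)%:E).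
Qed.

Lemma two_point_add (f g : X -> \bar R) :
  (two_point_fun (fun z => f z + g z)%dE
     <= (two_point_fun f + two_point_fun g)%dE)%E.
Proof. by rewrite /two_point_fun !daddeMr// daddeACA. Qed.

Lemma two_point_cst (a : R) : two_point_fun (fun=> a%:E) = a%:E.
Proof.
congr EFin; rewrite -[LHS]/(p * a + (1 - p) * a).
by rewrite -mulrDl addrC subrK mul1r.
Qed.

Definition two_point : outer_probability_content R X :=
  {| opc_fun := two_point_fun; opc_le := two_point_le;
     opc_scale := two_point_scale; opc_add := two_point_add;
     opc_cst := two_point_cst |}.

Lemma two_point_ge0E (f : X -> \bar R) : (forall z, 0 <= f z)%E ->
  two_point f = (p%:E * f x + (1 - p)%:E * f y)%E.
Proof.
move=> f0; rewrite /= /two_point_fun.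
have : (0 <= p%:E * f x)%E by rewrite mule_ge0// lee_fin ltW.
have : (0 <= (1 - p)%:E * f y)%E by rewrite mule_ge0// lee_fin ltW.
by case: (_ * f x)%E => [u| |]//; case: (_ * f y)%E.
Qed.

End TwoPointContent.

Section StakingPlay.
Context {R : realType} {X : Type} (x y : X) (q : R).
Hypothesis xy : x <> y.
Hypothesis q1 : 1 < q.
Variable S : rival_strategy R X.
Hypothesis legal_S : legal_strategy S.

Let q0 : 0 < q. Proof. exact: lt_trans q1. Qed.

Let q01 : 0 < q^-1 < 1.
Proof. by rewrite invr_gt0 q0 invf_lt1. Qed.

Let E := two_point x y q^-1 q01.

(** Since [x] has weight 1/q, this bet costs exactly Sceptic's current capital. *)
Let bet (h : seq (round R X)) (z : X) : \bar R :=
  if `[< z = x >] then (q%:E * capital h)%E else 0%E.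

Let next_round h z := Round E (bet h) (S h E (bet h)) z.

(* The history in which Reality's moves are [w] while Sceptic keeps staking all
   his capital on [x], at odds [q]. *)
Fixpoint staking_history (w : nat -> X) (n : nat) : seq (round R X) :=
  if n is m.+1 then
    let h := staking_history w m in rcons h (next_round h (w m))
  else [::].

Definition staking_play (w : nat -> X) (n : nat) : round R X :=
  next_round (staking_history w n) (w n).

Lemma mkseq_staking_play w n : mkseq (staking_play w) n = staking_history w n.
Proof. by elim: n => // n IH; rewrite mkseqS IH. Qed.

Let bet_x h : bet h x = (q%:E * capital h)%E.
Proof. by rewrite /bet asboolT. Qed.

Let bet_y h : bet h y = 0%E.
Proof. by rewrite /bet asboolF// => yx; apply: xy. Qed.

Let bet_legal h : (0 <= capital h)%E -> legal_bet E (capital h) (bet h).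
Proof.
move=> h0; have b0 z : (0 <= bet h z)%E.
  by rewrite /bet; case: asboolP => // _; rewrite mule_ge0// lee_fin ltW.
split=> //; rewrite two_point_ge0E// bet_x bet_y mule0 adde0 muleA -EFinM.
by rewrite mulVf ?gt_eqF// mul1e.
Qed.

Lemma staking_history_legal w n : legal_history (staking_history w n).
Proof.
elim: n => [|n IH] /=; first exact: legal_nil.
have b := bet_legal _ (legal_capital_ge0 _ IH).1.
by apply: legal_rcons => //=; apply: legal_S.
Qed.

Lemma staking_play_legal w : legal_play (staking_play w).
Proof. by move=> n; rewrite mkseq_staking_play; exact: staking_history_legal. Qed.

Lemma staking_play_follows w : follows S (staking_play w).
Proof. by move=> n; rewrite mkseq_staking_play. Qed.

Let up n := staking_history (fun=> x) n.

Let capital_up n : capital (up n) = (q ^+ n)%:E.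
Proof.
elim: n => [|n IH]; first by rewrite expr0.
by rewrite /up/= capital_rcons /= bet_x -/(up n) IH -EFinM exprS.
Qed.

Let max_capital_up n : max_capital (up n) = (q ^+ n)%:E.
Proof.
elim: n => [|n IH]; first by rewrite expr0 max_capital_nil.
rewrite /up/= max_capital_rcons -/(up n) IH -[rcons _ _]/(up n.+1) capital_up.
by rewrite max_r// lee_fin ler_weXn2l// ltW.
Qed.

(** Reality deviates from the constant sequence [x] only after [n] rounds; this tests the value at
    [y] of the bet that [S] makes after [up n]. *)
Let branch n k := if (k < n)%N then x else y.

Let staking_branch n k : (k <= n)%N -> staking_history (branch n) k = up k.
Proof.
elim: k => // k IH kn /=.
by rewrite IH ?(ltnW kn)// {1}/branch kn.
Qed.

Context (c : R) (F : R -> R).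
Hypothesis F_ge0 : forall y : R, 1 <= y -> 0 <= F y.
Hypothesis S_ensures : ensures S (fun p => forall n : nat,
  (c%:E * capital (mkseq p n) + extend_at_infty F (max_capital (mkseq p n))
     <= rival_capital (mkseq p n))%E).

Let insured w n : (c%:E * capital (staking_history w n)
    + extend_at_infty F (max_capital (staking_history w n))
  <= rival_capital (staking_history w n))%E.
Proof.
rewrite -mkseq_staking_play.
exact: S_ensures _ (staking_play_legal w) (staking_play_follows w) n.
Qed.

(** The left side bounds from below the price of the bet [S] makes after [up n]. Its value at [x] is
    the next rival capital; its value at [y] is at least F(q^n), because there Sceptic drops to 0
    while his maximum remains q^n. *)
Let rival_up n :
  (q^-1%:E * rival_capital (up n.+1) + ((1 - q^-1) * F (q ^+ n))%:E
   <= rival_capital (up n))%E.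
Proof.
have hn := staking_history_legal (fun=> x) n.
have [g0 gE] := legal_S _ _ _ hn (bet_legal _ (legal_capital_ge0 _ hn).1).
apply: le_trans gE; rewrite two_point_ge0E//.
rewrite {1}/up/= rival_capital_rcons/= leeD2l// EFinM lee_wpmul2l//.
  by rewrite lee_fin subr_ge0 ltW//; case/andP: q01.
have := insured (branch n) n.+1.
rewrite /= staking_branch// {1 2 3}/branch ltnn.
rewrite capital_rcons max_capital_rcons capital_rcons rival_capital_rcons/=.
rewrite bet_y mule0 add0e max_capital_up max_l//.
by rewrite lee_fin exprn_ge0// ltW.
Qed.

(** Along [up], Rival Sceptic's capital divided by q^n starts at 1 and loses at least the summand of
    index n in each round. It must stay at least c, as Sceptic's capital is q^n. *)
Lemma staking_sum_le n :
  \sum_(i < n) (1 - q^-1) * (F (q ^+ i) / q ^+ i) <= 1 - c.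
Proof.
have qn0 m : 0 < q ^+ m by rewrite exprn_gt0.
have Fq0 m : 0 <= F (q ^+ m) / q ^+ m.
  by rewrite divr_ge0 ?F_ge0 ?exprn_ege1 ?ltW.
(* Finiteness is carried along: by [rival_up], an infinite capital after the next round would need
   an infinite one now. *)
have [v vE] : exists v : R, rival_capital (up n) = v%:E /\
    v / q ^+ n <= 1 - \sum_(i < n) (1 - q^-1) * (F (q ^+ i) / q ^+ i).
  elim: n => [|n [v [vE vle]]].
    by exists 1; rewrite big_ord0 expr0 divr1 subr0.
  have := rival_up n; rewrite vE.
  have := (legal_capital_ge0 _ (staking_history_legal (fun=> x) n.+1)).2.
  rewrite -/(up _); case: (rival_capital _) => [u _| |]//; last first.
    by rewrite gt0_muley ?lte_fin ?invr_gt0//= => _; rewrite leye_eq.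
  rewrite -EFinM -EFinD lee_fin => uv; exists u; split=> //.
  rewrite big_ord_recr/= opprD addrA lerBrDr; apply: le_trans vle.
  rewrite -(ler_pM2r (qn0 n)) divfK ?gt_eqF//; apply: le_trans uv.
  rewrite le_eqVlt; apply/orP; left; apply/eqP.
  by rewrite exprSr; field; rewrite !gt_eqF.
case: vE => vE; have := insured (fun=> x) n.
rewrite -/(up n) capital_up max_capital_up vE /= -EFinM -EFinD lee_fin.
move=> cv vle; have : c <= v / q ^+ n.
  rewrite ler_pdivlMr//; apply: le_trans cv.
  by rewrite lerDl F_ge0// exprn_ege1// ltW.
by move: vle; lra.
Qed.

End StakingPlay.

(** * Equivalence with the integral condition *)

Theorem corollary1 (R : realType) (X : Type)
    (X_two : exists x y : X, x <> y)
    (c : R) (c_ge0 : 0 <= c)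
    (F : R -> R)
    (F_ge0 : forall y : R, 1 <= y -> 0 <= F y)
    (F_incr : forall y z : R, 1 <= y -> y <= z -> F y <= F z) :
  (exists S : rival_strategy R X,
     legal_strategy S /\
     ensures S (fun p => forall n : nat,
       (c%:E * capital (mkseq p n)
          + extend_at_infty F (max_capital (mkseq p n))
        <= rival_capital (mkseq p n))%E))
  <->
  (\int[lebesgue_measure]_(y in `[1%R, +oo[) (F y / y ^+ 2)%:E
     <= (1 - c)%:E)%E.
Proof.
split=> [[S [legal_S S_ensures]]|].
  have [x [y xy]] := X_two.
  have sum_le q (q1 : 1 < q) n :=
    staking_sum_le x y q xy q1 S legal_S c F F_ge0 S_ensures n.
  apply/lee_addgt0Pr => e e0.
  (* The empty sum already gives c <= 1, for any q. *)
  have c1 : 0 <= 1 - c by have := sum_le 2 (ltr1n _ 2) 0; rewrite big_ord0.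
  (* Then (q - 1)(1 - c) = e (1 - c)/(2 - c) <= e; the denominator 2 - c stays positive even when c
     = 1. *)
  pose q := 1 + e / (2 - c).
  have q1 : 1 < q by rewrite /q ltrDl divr_gt0//; lra.
  have := integral_geometric_le F c F_ge0 F_incr q q1 (sum_le q q1).
  move=> /le_trans; apply; rewrite -EFinD lee_fin /q mulrDl mul1r lerD2l.
  by rewrite mulrAC ler_pdivrMr ?ler_pM2l//; lra.
move=> /(exists_slope F F_ge0 F_incr)[G [G1 G0 FG]].
exists (slope_strategy c F G); split; first exact: slope_strategy_legal.
exact: slope_strategy_ensures.
Qed.
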